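(* Let $k\ge 1$, and let $x_{k-1}=V_k\bar y_{k-1}$ and $\lambda_{k-1}>0$ be the iterates of the projected Newton iteration described in the context, where $V_k\in\mathbb{R}^{n\times k}$ is the Generalized Krylov subspace basis, i.e. $V_k$ has orthonormal columns and $\mathcal{R}(V_k)=\operatorname{span}\{\tilde v_0,\ldots,\tilde v_{k-1}\}$. Assume that the projected Jacobian $J^{(k)}(\bar y_{k-1},\lambda_{k-1})$ is nonsingular and let $(\Delta y_k^T,\Delta\lambda_k)^T\in\mathbb{R}^{k+1}$ be the projected Newton direction, i.e. the solution of $$J^{(k)}(\bar y_{k-1},\lambda_{k-1})\begin{pmatrix}\Delta y_k\\ \Delta\lambda_k\end{pmatrix}=-F^{(k)}(\bar y_{k-1},\lambda_{k-1}).$$ Put $\Delta x_k=V_k\Delta y_k$ and $\Delta_k=(\Delta x_k^T,\Delta\lambda_k)^T\in\mathbb{R}^{n+1}$. Then either $\Delta_k$ is a descent direction for the merit function $f(x,\lambda)=\frac12\|F(x,\lambda)\|_2^2$ at $(x_{k-1},\lambda_{k-1})$, that is, $$\Delta_k^T\,\nabla f(x_{k-1},\lambda_{k-1})<0,$$ or $x_{k-1}$ is a (global) solution, with Lagrange multiplier $\lambda_{k-1}$, of the constrained problem $$\min_{x\in\mathbb{R}^n}\Psi(x)\quad\text{subject to}\quad \tfrac12\|Ax-b\|_2^2=\tfrac{\sigma^2}{2}.$$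
   Context: Setting. $A\in\mathbb{R}^{m\times n}$, $b\in\mathbb{R}^m$, $\sigma>0$ with $\|b\|_2>\sigma$, and $\Psi:\mathbb{R}^n\to\mathbb{R}$ is convex and twice continuously differentiable with $\nabla\Psi(0)=0$. $\mathcal{R}(\cdot)$ denotes the range (column space) of a matrix. Define $$F(x,\lambda)=\begin{pmatrix}\lambda A^T(Ax-b)+\nabla\Psi(x)\\ \frac12\|Ax-b\|_2^2-\frac{\sigma^2}{2}\end{pmatrix}\in\mathbb{R}^{n+1},\qquad (x,\lambda)\in\mathbb{R}^n\times\mathbb{R}.$$ For a matrix $V_k\in\mathbb{R}^{n\times k}$ with orthonormal columns, the projected function and projected Jacobian are, for $(y,\lambda)\in\mathbb{R}^k\times\mathbb{R}$, $$F^{(k)}(y,\lambda)=\begin{pmatrix}\lambda V_k^TA^T(AV_ky-b)+V_k^T\nabla\Psi(V_ky)\\ \frac12\|AV_ky-b\|_2^2-\frac{\sigma^2}{2}\end{pmatrix},$$ $$J^{(k)}(y,\lambda)=\begin{pmatrix}\lambda V_k^TA^TAV_k+V_k^T\nabla^2\Psi(V_ky)V_k & V_k^TA^T(AV_ky-b)\\ (AV_ky-b)^TAV_k & 0\end{pmatrix}.$$ Projected Newton iteration. Start with $x_0=0$, $\bar y_0=0\in\mathbb{R}^1$ and some $\lambda_0>0$. For $j\ge0$ let $$\tilde v_j=\lambda_jA^T(Ax_j-b)+\nabla\Psi(x_j).$$ $V_1=\tilde v_0/\|\tilde v_0\|$, and $V_{j+1}=[V_j,v_j]$, where $v_j$ is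 obtained by orthogonalizing $\tilde v_j$ against the columns of $V_j$ (Gram–Schmidt) and normalizing; thus $V_{j+1}$ has orthonormal columns and range $\operatorname{span}\{\tilde v_0,\dots,\tilde v_j\}$. In iteration $j\ge1$, provided $J^{(j)}(\bar y_{j-1},\lambda_{j-1})$ is nonsingular, one solves $J^{(j)}(\bar y_{j-1},\lambda_{j-1})(\Delta y_j^T,\Delta\lambda_j)^T=-F^{(j)}(\bar y_{j-1},\lambda_{j-1})$, chooses a step-length $0<\gamma_j\le1$, and sets $y_j=\bar y_{j-1}+\gamma_j\Delta y_j$, $\lambda_j=\lambda_{j-1}+\gamma_j\Delta\lambda_j$, $x_j=V_jy_j$, and $\bar y_j=(y_j^T,0)^T\in\mathbb{R}^{j+1}$ (so that $V_{j+1}\bar y_j=x_j$). *)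

(* Defs.v *)
From HB Require Import structures.
From mathcomp Require Import all_boot all_order all_algebra.
From mathcomp Require Import all_classical all_reals all_analysis.

Set Implicit Arguments.
Unset Strict Implicit.
Unset Printing Implicit Defensive.

Import Order.TTheory GRing.Theory Num.Theory.
Import numFieldNormedType.Exports.

Local Open Scope classical_set_scope.
Local Open Scope ring_scope.

(* The library norm `|x| on 'cV[R]_n is the max norm. It is used only through
   the topology it induces (differentiability, continuity); the norm of the
   problem is the Euclidean one. *)
Definition norm2 (R : realType) (n : nat) (x : 'cV[R]_n) : R :=
  Num.sqrt (\sum_(i < n) x i 0 ^+ 2).

Definition grad (R : realType) (n : nat) (f : 'cV[R]_n -> R^o)
    (x : 'cV[R]_n) : 'cV[R]_n :=
  \col_i 'D_(delta_mx i 0) f x.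

Definition hessian (R : realType) (n : nat) (f : 'cV[R]_n -> R^o)
    (x : 'cV[R]_n) : 'M[R]_n :=
  \matrix_(i, j) 'D_(delta_mx j 0) (fun z => grad f z i 0 : R^o) x.

Definition twice_continuously_differentiable (R : realType) (n : nat)
    (f : 'cV[R]_n -> R^o) : Prop :=
  [/\ forall x, differentiable f x,
      forall x, differentiable (grad f) x
    & continuous (hessian f)].

Section Problem.
Context (R : realType) (m n : nat).
Variables (A : 'M[R]_(m, n)) (b : 'cV[R]_m) (sigma : R).
Variable Psi : 'cV[R]_n -> R^o.

Definition constraint (x : 'cV[R]_n) : R^o :=
  2^-1 * norm2 (A *m x - b) ^+ 2 - sigma ^+ 2 / 2.

Definition feasible (x : 'cV[R]_n) : Prop :=
  2^-1 * norm2 (A *m x - b) ^+ 2 = sigma ^+ 2 / 2.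

Definition global_solution (x : 'cV[R]_n) : Prop :=
  feasible x /\ forall z, feasible z -> Psi x <= Psi z.

Definition lagrange_multiplier (x : 'cV[R]_n) (lambda : R) : Prop :=
  grad Psi x + lambda *: grad constraint x = 0.

Definition Ffun (x : 'cV[R]_n) (lambda : R) : 'cV[R]_(n + 1) :=
  col_mx (lambda *: (A^T *m (A *m x - b)) + grad Psi x)
         (2^-1 * norm2 (A *m x - b) ^+ 2 - sigma ^+ 2 / 2)%:M.

(* A point (x, lambda) of R^n x R is encoded as the column vector
   col_mx x lambda%:M. *)
Definition merit (z : 'cV[R]_(n + 1)) : R^o :=
  2^-1 * norm2 (Ffun (usubmx z) (dsubmx z 0 0)) ^+ 2.

Definition projF (k : nat) (V : 'M[R]_(n, k)) (y : 'cV[R]_k) (lambda : R) :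
    'cV[R]_(k + 1) :=
  col_mx (lambda *: (V^T *m A^T *m (A *m V *m y - b))
            + V^T *m grad Psi (V *m y))
         (2^-1 * norm2 (A *m V *m y - b) ^+ 2 - sigma ^+ 2 / 2)%:M.

Definition projJ (k : nat) (V : 'M[R]_(n, k)) (y : 'cV[R]_k) (lambda : R) :
    'M[R]_(k + 1) :=
  block_mx (lambda *: (V^T *m A^T *m A *m V)
              + V^T *m hessian Psi (V *m y) *m V)
           (V^T *m A^T *m (A *m V *m y - b))
           ((A *m V *m y - b)^T *m A *m V)
           0.

Definition newton_direction (k : nat) (V : 'M[R]_(n, k)) (y : 'cV[R]_k)
    (lambda : R) (dy : 'cV[R]_k) (dlambda : R) : Prop :=
  projJ V y lambda *m col_mx dy dlambda%:M = - projF V y lambda.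

(* One Gram-Schmidt step against the orthonormal columns of V. When v lies in
   the range of V (breakdown) the value is 0, so a matrix built with it does
   not have orthonormal columns. *)
Definition gram_schmidt (k : nat) (V : 'M[R]_(n, k)) (v : 'cV[R]_n) :
    'cV[R]_n :=
  let w := v - V *m (V^T *m v) in (norm2 w)^-1 *: w.

(* The families are total: the values V_ 0, y_ 0, dy_ 0, dlam_ 0, gamma_ 0 and
   those beyond the iterations performed are irrelevant. *)
Record pn_iterates := PnIterates {
  V_ : forall j, 'M[R]_(n, j);
  x_ : nat -> 'cV[R]_n;
  y_ : forall j, 'cV[R]_j;
  ybar_ : forall j, 'cV[R]_(j + 1);
  lam_ : nat -> R;
  dy_ : forall j, 'cV[R]_j;
  dlam_ : nat -> R;
  gamma_ : nat -> R }.

Definition vtilde (s : pn_iterates) (j : nat) : 'cV[R]_n :=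
  lam_ s j *: (A^T *m (A *m x_ s j - b)) + grad Psi (x_ s j).

(* Iteration i + 1, which starts from V_{i+1}, ybar_i, lambda_i and ends with
   the construction of V_{i+2}. The successors are written i + 1 so that the
   block matrices have the expected sizes definitionally. *)
Record pn_iteration (s : pn_iterates) (i : nat) : Prop := PnIteration {
  pn_nonsingular : projJ (V_ s (i + 1)) (ybar_ s i) (lam_ s i) \in unitmx;
  pn_direction : newton_direction (V_ s (i + 1)) (ybar_ s i) (lam_ s i)
                   (dy_ s (i + 1)) (dlam_ s (i + 1));
  pn_step_length : 0 < gamma_ s (i + 1) <= 1;
  pn_y : y_ s (i + 1) = ybar_ s i + gamma_ s (i + 1) *: dy_ s (i + 1);
  pn_lam : lam_ s (i + 1) = lam_ s i + gamma_ s (i + 1) * dlam_ s (i + 1);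
  pn_x : x_ s (i + 1) = V_ s (i + 1) *m y_ s (i + 1);
  pn_ybar : ybar_ s (i + 1) = col_mx (y_ s (i + 1)) 0;
  pn_V : V_ s (i + 1 + 1) =
         row_mx (V_ s (i + 1))
                (gram_schmidt (V_ s (i + 1)) (vtilde s (i + 1))) }.

(* s records a run of the method in which iterations 1, ..., j have been
   carried out, so that V_{j+1}, ybar_j, x_j and lambda_j are available. *)
Record projected_newton_run (s : pn_iterates) (j : nat) : Prop :=
  ProjectedNewtonRun {
    pn_x0 : x_ s 0 = 0;
    pn_ybar0 : ybar_ s 0 = 0;
    pn_lam0 : 0 < lam_ s 0;
    pn_V1 : V_ s 1 = (norm2 (vtilde s 0))^-1 *: vtilde s 0;
    pn_iter : forall i, (i < j)%N -> pn_iteration s i }.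

(* V has orthonormal columns and its range is span{vtilde_0, ..., vtilde_{k-1}};
   column spaces are expressed as row spaces of transposes. *)
Definition krylov_basis (s : pn_iterates) (k : nat) (V : 'M[R]_(n, k)) : Prop :=
  V^T *m V = 1%:M /\ (V^T :=: \matrix_(i < k) (vtilde s i)^T)%MS.

End Problem.

(* Main.v *)
(* With F = (F_1, F_2) and J the Jacobian of F, the gradient of the merit
   function is J^T F. Since F_1(x_{k-1}, lambda_{k-1}) is the last vector added
   to the Krylov space, projecting onto that space loses nothing, and the
   projected Newton equation gives Delta^T grad f = - |F|^2 < 0 unless F = 0.
   If F = 0, then x_{k-1} is feasible and stationary for the Lagrangian, which
   is convex because lambda_{k-1} > 0; hence x_{k-1} is a global minimizer. *)
Require Import Defs.
From HB Require Import structures.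
From mathcomp Require Import all_boot all_order all_algebra.
From mathcomp Require Import all_classical all_reals all_analysis.
From mathcomp Require Import lra.

Set Implicit Arguments.
Unset Strict Implicit.
Unset Printing Implicit Defensive.

Import Order.TTheory GRing.Theory Num.Theory.
Import numFieldNormedType.Exports.

Local Open Scope classical_set_scope.
Local Open Scope ring_scope.

(** * Euclidean norm *)

Lemma norm2_sqr (R : realType) (n : nat) (x : 'cV[R]_n) :
  norm2 x ^+ 2 = (x^T *m x) 0 0.
Proof.
rewrite sqr_sqrtr; last by apply: sumr_ge0 => i _; exact: sqr_ge0.
by rewrite mxE; apply: eq_bigr => i _; rewrite mxE.
Qed.

Lemma norm2_eq0 (R : realType) (n : nat) (x : 'cV[R]_n) :
  norm2 x = 0 -> x = 0.
Proof.
move=> /(congr1 (fun t => t ^+ 2)); rewrite expr0n norm2_sqr mxE => /eqP.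
rewrite psumr_eq0 => [/allP x0|i _]; last by rewrite mxE -expr2 sqr_ge0.
apply/matrixP => i j; rewrite (ord1 j) [RHS]mxE.
by have := x0 i (mem_index_enum _); rewrite mxE mulf_eq0 orbb => /eqP.
Qed.

(** * Directional derivatives, gradients and first-order convexity *)

Section DirectionalDerivative.
Context (R : realType).

(** Linearity of [L] turns the difference quotient of [f \o L] at [x] along [v] into that of [f] at
    [L x] along [L v], so both limits are the same. *)
Lemma is_derive_comp_linear (U V W : normedModType R) (L : U -> V)
    (f : V -> W) (x v : U) (df : W) :
  linear L -> is_derive (L x) (L v) f df -> is_derive x v (f \o L) df.
Proof.
move=> linL [dfx <-].
have E : (fun h : R => h^-1 *: (((f \o L) \o shift x) (h *: v) - (f \o L) x))
       = (fun h : R => h^-1 *: ((f \o shift (L x)) (h *: L v) - f (L x))).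
  by apply/funext => h /=; rewrite linL.
by split; rewrite /derivable /derive E.
Qed.

Lemma is_derive_linear (V W : normedModType R) (L : V -> W) (x v : V) :
  linear L -> is_derive x v L (L v).
Proof. by move=> linL; apply: (@is_derive_comp_linear _ _ _ L id). Qed.

Lemma is_derive_affine (V W : normedModType R) (L : V -> W)
    (c : W) (x v : V) :
  linear L -> is_derive x v (fun u => L u - c) (L v).
Proof.
move=> linL; rewrite -[L v]subr0.
exact: (is_deriveB (is_derive_linear x v linL) (is_derive_cst c x v)).
Qed.

Lemma is_derive_mx (V : normedModType R) (m n : nat) (M : V -> 'M[R]_(m, n))
    (x v : V) (dM : 'M[R]_(m, n)) :
  is_derive x v M dM <->
  forall i j, is_derive x v (fun u => M u i j : R^o) (dM i j).
Proof.
split=> [[Mx <-] i j|dMx].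
  by split; [have /derivable_mxP := Mx; exact|rewrite derive_mx// mxE].
have Mx : derivable M x v by apply/derivable_mxP => i j; case: (dMx i j).
split=> //; rewrite derive_mx//; apply/matrixP => i j; rewrite mxE.
by case: (dMx i j).
Qed.

Lemma is_derive_col_mx (V : normedModType R) (m1 m2 n : nat)
    (M : V -> 'M[R]_(m1, n)) (N : V -> 'M[R]_(m2, n)) (x v : V)
    (dM : 'M[R]_(m1, n)) (dN : 'M[R]_(m2, n)) :
  is_derive x v M dM -> is_derive x v N dN ->
  is_derive x v (fun u => col_mx (M u) (N u)) (col_mx dM dN).
Proof.
move=> /is_derive_mx dMx /is_derive_mx dNx; apply/is_derive_mx => i j.
case: (split_ordP i) => k ->.
  by under eq_fun do rewrite col_mxEu; rewrite col_mxEu.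
by under eq_fun do rewrite col_mxEd; rewrite col_mxEd.
Qed.

Lemma is_derive_scalemx (V : normedModType R) (m n : nat) (c : V -> R^o)
    (M : V -> 'M[R]_(m, n)) (x v : V) (dc : R) (dM : 'M[R]_(m, n)) :
  is_derive x v c dc -> is_derive x v M dM ->
  is_derive x v (fun u => c u *: M u) (c x *: dM + dc *: M x).
Proof.
move=> dcx /is_derive_mx dMx; apply/is_derive_mx => i j.
under eq_fun do rewrite mxE.
have -> : (fun u => c u * M u i j) = (c : V -> R^o) * (fun u => M u i j).
  by [].
apply: (is_derive_eq (is_deriveM dcx (dMx i j))).
by rewrite !mxE [M x i j *: _]mulrC.
Qed.

Lemma is_derive_half_norm2_sqr (V : normedModType R) (n : nat)
    (G : V -> 'cV[R]_n) (x v : V) (dG : 'cV[R]_n) :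
  is_derive x v G dG ->
  is_derive x v (fun u => 2^-1 * norm2 (G u) ^+ 2 : R^o)
    (((G x)^T *m dG) 0 0).
Proof.
move=> /is_derive_mx dGx.
have -> : (fun u => 2^-1 * norm2 (G u) ^+ 2 : R^o) =
    2^-1 \*: (\sum_(i < n) ((fun u => G u i 0 : R^o) ^+ 2)).
  apply/funext => u; rewrite norm2_sqr mxE /= fct_sumE.
  by congr (_ * _); apply: eq_bigr => i _; rewrite mxE -expr2.
have dsum := is_derive_sum (fun i => is_deriveX 2 (dGx i 0)).
apply: (is_derive_eq (is_deriveZ 2^-1 dsum)).
rewrite scaler_sumr mxE; apply: eq_bigr => i _.
by rewrite scalerA mulrA mulVf ?mul1r ?pnatr_eq0// mxE expr1.
Qed.

Lemma is_derive_grad (n : nat) (f : 'cV[R]_n -> R^o) (x v : 'cV[R]_n) :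
  differentiable f x -> is_derive x v f (((grad f x)^T *m v) 0 0).
Proof.
move=> dfx; split; first exact: diff_derivable.
(* Expanding [v] in the standard basis lets linearity of the differential reduce everything to the
   partial derivatives. *)
rewrite mxE deriveE// [v in LHS](_ : v = \sum_i v i 0 *: delta_mx i 0);
  last first.
  apply/matrixP => i k; rewrite (ord1 k) summxE (bigD1 i)//= !mxE !eqxx mulr1.
  rewrite big1 ?addr0// => l li.
  by rewrite !mxE [i == l]eq_sym (negbTE li) mulr0.
rewrite linear_sum; apply: eq_bigr => i _.
by rewrite linearZ /= !mxE mulrC deriveE.
Qed.

Lemma is_derive_hessian (n : nat) (f : 'cV[R]_n -> R^o) (x v : 'cV[R]_n) :
  differentiable (grad f) x -> is_derive x v (grad f) (hessian f x *m v).
Proof.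
move=> dfx; apply/is_derive_mx => i j; rewrite (ord1 j).
have dfi : differentiable (fun u => grad f u i 0 : R^o) x.
  apply: (@differentiable_comp _ _ _ _ (grad f) (fun M => M i 0 : R^o)) => //.
  exact: differentiable_coord.
apply: is_derive_eq; first exact: is_derive_grad.
by rewrite !mxE; apply: eq_bigr => k _; rewrite !mxE.
Qed.

(** Reads a gradient off a formula for all directional derivatives; the basis vectors already
    determine its coordinates. *)
Lemma grad_eq (n : nat) (f : 'cV[R]_n -> R^o) (x g : 'cV[R]_n) :
  (forall v, is_derive x v f ((g^T *m v) 0 0)) -> grad f x = g.
Proof.
move=> dfx; apply/matrixP => i k; rewrite (ord1 k) mxE.
case: (dfx (delta_mx i 0)) => _ ->.
by rewrite -colE !mxE.
Qed.

(** For 0 < h <= 1, convexity bounds the difference quotient along [z - x] by [f z - f x]; the bound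
    survives the limit h -> 0. *)
Lemma convex_grad_le (n : nat) (f : 'cV[R]_n -> R^o) (x z : 'cV[R]_n) :
  @convex_function R 'cV[R]_n [set: _] f -> differentiable f x ->
  f x + ((grad f x)^T *m (z - x)) 0 0 <= f z.
Proof.
move=> cvxf dfx; rewrite -lerBrDl.
have [df <-] := is_derive_grad (z - x) dfx.
(* The quotient is bounded only for positive h, so the two-sided limit is traded for the right one,
   which exists because its filter refines the punctured one. *)
rewrite ['D_ _ _ _]cvg_at_rightE//; apply: limr_le.
  rewrite -(cvg_at_rightE (fun h : R => h^-1 *: ((f \o shift x) _ - f x))) //.
  apply: cvg_trans df; apply: cvg_app.
  move=> B [e e0 Be]; exists e => // t te t0; apply: Be => //.
  exact/lt0r_neq0.
near=> h.
have h0 : 0 < h by near: h; exists 1 => /=.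
have h1 : h <= 1.
  near: h; exists 1 => [/=|t /=]; [exact: ltr01|].
  rewrite distrC subr0 => /ltW t1 _.
  exact: le_trans (ler_norm _) t1.
(* Multiplied by h, the bound is convexity at the point h z + (1 - h) x. *)
rewrite /= -(ler_pM2l h0) mulrA mulfV ?gt_eqF// mul1r lerBlDr.
have -> : h *: (z - x) + x = h *: z + (1 - h) *: x.
  by rewrite scalerBr scalerBl scale1r [x - _]addrC addrA.
have -> : h * (f z - f x) + f x = h * f z + (1 - h) * f x.
  by rewrite mulrBr mulrBl mul1r [f x - _]addrC addrA.
exact: (cvxf (Itv01 (ltW h0) h1) z x (in_setT _) (in_setT _)).
Unshelve. all: by end_near. Qed.

End DirectionalDerivative.

(** * Gradient of the merit function, the descent identity, and zeros of F *)

Section Descent.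
Context (R : realType) (m n : nat).
Variables (A : 'M[R]_(m, n)) (b : 'cV[R]_m) (sigma : R).
Variable Psi : 'cV[R]_n -> R^o.

(** The Jacobian of [Ffun] in (x, lambda), before projection. *)
Definition jacobian (x : 'cV[R]_n) (lambda : R) : 'M[R]_(n + 1) :=
  block_mx (lambda *: (A^T *m A) + hessian Psi x) (A^T *m (A *m x - b))
           ((A *m x - b)^T *m A) 0.

Lemma grad_constraint (x : 'cV[R]_n) :
  grad (constraint A b sigma) x = A^T *m (A *m x - b).
Proof.
apply: grad_eq => v; rewrite trmx_mul trmxK -mulmxA.
(* The zero is the derivative of the constant [sigma ^+ 2 / 2], made explicit for the difference
   rule. *)
rewrite -[X in is_derive _ _ _ X]subr0.
have dr : is_derive x v (fun u => A *m u - b) (A *m v).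
  apply: is_derive_affine => a u w; exact: linearP.
exact: (is_deriveB (is_derive_half_norm2_sqr dr)
          (is_derive_cst (sigma ^+ 2 / 2 : R^o) x v)).
Qed.

Lemma is_derive_Ffun (z v : 'cV[R]_(n + 1)) :
  differentiable (grad Psi) (usubmx z) ->
  is_derive z v (fun u => Ffun A b sigma Psi (usubmx u) (dsubmx u 0 0))
    (jacobian (usubmx z) (dsubmx z 0 0) *m v).
Proof.
move=> dPsi.
have linu : linear (fun u : 'cV[R]_(n + 1) => usubmx u).
  by move=> a u w; exact: linearP.
have dl : is_derive z v (fun u : 'cV[R]_(n + 1) => dsubmx u 0 0 : R^o)
    (dsubmx v 0 0).
  by apply: is_derive_linear => a u w; rewrite !mxE.
have dr : is_derive z v (fun u => A *m usubmx u - b) (A *m usubmx v).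
  by apply: is_derive_affine => a u w; rewrite linearP /= linearP.
have dg : is_derive z v (fun u => A^T *m (A *m usubmx u - b))
    (A^T *m A *m usubmx v).
  under eq_fun do rewrite mulmxBr mulmxA.
  by apply: is_derive_affine => a u w; rewrite linearP /= linearP.
have dh : is_derive z v (fun u => grad Psi (usubmx u))
    (hessian Psi (usubmx z) *m usubmx v).
  exact: (is_derive_comp_linear linu (is_derive_hessian _ dPsi)).
have dc : is_derive z v
    (fun u => 2^-1 * norm2 (A *m usubmx u - b) ^+ 2 - sigma ^+ 2 / 2 : R^o)
    (((A *m usubmx z - b)^T *m (A *m usubmx v)) 0 0).
  rewrite -[X in is_derive _ _ _ X]subr0.
  exact: (is_deriveB (is_derive_half_norm2_sqr dr)
            (is_derive_cst (sigma ^+ 2 / 2 : R^o) z v)).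
have dcM : is_derive z v
    (fun u =>
       (2^-1 * norm2 (A *m usubmx u - b) ^+ 2 - sigma ^+ 2 / 2)%:M : 'cV[R]_1)
    ((A *m usubmx z - b)^T *m (A *m usubmx v)).
  apply/is_derive_mx => i k; rewrite (ord1 i) (ord1 k).
  by under eq_fun do rewrite mxE eqxx mulr1n.
apply: is_derive_eq.
  apply: is_derive_col_mx dcM; exact: (is_deriveD (is_derive_scalemx dl dg) dh).
(* Splitting [v] into its x-part and lambda-part matches the block product with the derivatives
   found above. *)
rewrite -[v in RHS]vsubmxK mul_block_col mul0mx addr0 mulmxA; congr col_mx.
rewrite mulmxDl -scalemxAl addrAC.
by rewrite [in RHS](mx11_scalar (dsubmx v)) mul_mx_scalar.
Qed.

(** By the chain rule the derivative of |F|^2 / 2 along v is F^T J v, that is, (J^T F)^T v. *)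
Lemma grad_merit (x : 'cV[R]_n) (lambda : R) :
  differentiable (grad Psi) x ->
  grad (merit A b sigma Psi) (col_mx x lambda%:M) =
  (jacobian x lambda)^T *m Ffun A b sigma Psi x lambda.
Proof.
move=> dPsi; apply: grad_eq => v.
have lamE : (lambda%:M : 'M[R]_1) 0 0 = lambda by rewrite mxE.
have := @is_derive_Ffun (col_mx x lambda%:M) v.
rewrite col_mxKu col_mxKd lamE => /(_ dPsi) /is_derive_half_norm2_sqr.
by rewrite col_mxKu col_mxKd lamE trmx_mul trmxK mulmxA.
Qed.

(* Since F_1 lies in the range of V, it may be replaced by V V^T F_1, which
   turns F^T J Delta into projF^T projJ (dy, dlam). *)
Lemma newton_direction_descent (k : nat) (V : 'M[R]_(n, k)) (y : 'cV[R]_k)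
    (lambda : R) (dy : 'cV[R]_k) (dlam : R) :
  let x := V *m y in
  differentiable (grad Psi) x ->
  V *m V^T *m (lambda *: (A^T *m (A *m x - b)) + grad Psi x) =
    lambda *: (A^T *m (A *m x - b)) + grad Psi x ->
  newton_direction A b sigma Psi V y lambda dy dlam ->
  ((col_mx (V *m dy) dlam%:M)^T *m
     grad (merit A b sigma Psi) (col_mx x lambda%:M)) 0 0 =
  - norm2 (Ffun A b sigma Psi x lambda) ^+ 2.
Proof.
move=> x dPsi; set F1 := _ + grad Psi x => VF1.
rewrite /newton_direction => dir.
(* [W] = diag(V, 1) embeds the projected unknowns (y, lambda) into the full space; [projF] and
   [projJ] are W^T F and W^T J W. *)
pose W := block_mx V 0 0 (1%:M : 'M[R]_1).
have projFE : projF A b sigma Psi V y lambda =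
    W^T *m Ffun A b sigma Psi x lambda.
  rewrite tr_block_mx mul_block_col !trmx0 !mul0mx trmx1 mul1mx addr0 add0r.
  by rewrite /F1 /projF (mulmxDr V^T) -scalemxAr /x !mulmxA.
have projJE : projJ A b Psi V y lambda = W^T *m jacobian x lambda *m W.
  rewrite /projJ /jacobian tr_block_mx !mulmx_block !trmx0 !mul0mx !mulmx0.
  rewrite trmx1 !mul1mx !mulmx1 !addr0 !add0r.
  by rewrite (mulmxDr V^T) (mulmxDl _ _ V) -scalemxAr -scalemxAl /x !mulmxA.
have WF : W *m (W^T *m Ffun A b sigma Psi x lambda) =
    Ffun A b sigma Psi x lambda.
  rewrite mulmxA tr_block_mx mulmx_block !trmx0 trmx1 !mul0mx !mulmx0 mulmx1.
  by rewrite !addr0 !add0r mul_block_col !mul0mx mul1mx addr0 add0r VF1.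
have -> : col_mx (V *m dy) dlam%:M = W *m col_mx dy dlam%:M.
  by rewrite mul_block_col !mul0mx mul1mx addr0 add0r.
set F := Ffun _ _ _ _ _ _ in projFE WF *.
(* Replacing F^T by (W W^T F)^T exposes W^T J W, to which the projected Newton equation applies. *)
have FJ : F^T *m (jacobian x lambda *m (W *m col_mx dy dlam%:M)) = - (F^T *m F).
  rewrite -{1}WF trmx_mul -mulmxA (mulmxA W^T) (mulmxA (W^T *m _)) -projJE.
  by rewrite dir projFE mulmxN trmx_mul trmxK -mulmxA WF.
(* Delta^T J^T F is a 1 x 1 matrix, the transpose of F^T J Delta. *)
rewrite grad_merit// norm2_sqr -/F mulmxA -trmx_mul.
by rewrite -[X in _ *m X]trmxK -trmx_mul FJ !mxE.
Qed.

(** With r = A x - b and d = z - x, stationarity makes the first-order term of [Psi] equal to -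
    lambda r^T A d. Feasibility of both points gives |r + A d| = |r|, hence 2 r^T A d = - |A d|^2 <=
    0, so that term is nonnegative. *)
Lemma Ffun_eq0_solution (x : 'cV[R]_n) (lambda : R) :
  @convex_function R 'cV[R]_n [set: _] Psi -> differentiable Psi x ->
  0 <= lambda -> Ffun A b sigma Psi x lambda = 0 ->
  global_solution A b sigma Psi x /\ lagrange_multiplier A b sigma Psi x lambda.
Proof.
move=> cvx dPsi lam0; rewrite /Ffun -col_mx0 => /eq_col_mx[stat feas].
have {}feas : feasible A b sigma x.
  have /eqP := congr1 (fun M : 'M[R]_1 => M 0 0) feas.
  by rewrite !mxE subr_eq0 => /eqP.
split; last by rewrite /lagrange_multiplier grad_constraint addrC.
split=> // z feasz; apply: le_trans (convex_grad_le z cvx dPsi).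
rewrite lerDl; set d := z - x; set r := A *m x - b in stat *.
have {stat} -> : grad Psi x = - (lambda *: (A^T *m r)).
  by apply/eqP; rewrite -addr_eq0 addrC stat.
have rz : A *m z - b = r + A *m d.
  by rewrite /r /d mulmxBr addrAC [A *m x + _]addrC subrK.
have eqn : (r^T *m r) 0 0 = ((r + A *m d)^T *m (r + A *m d)) 0 0.
  rewrite -!norm2_sqr -rz; apply: (@mulfI _ 2^-1).
    by rewrite invr_eq0 pnatr_eq0.
  by rewrite feasz.
have sym : ((A *m d)^T *m r) 0 0 = (r^T *m (A *m d)) 0 0.
  by rewrite -[in RHS](trmxK (A *m d)) -trmx_mul [RHS]mxE.
have ge0 : 0 <= ((A *m d)^T *m (A *m d)) 0 0 by rewrite -norm2_sqr sqr_ge0.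
clearbody r d.
have le0 : (r^T *m (A *m d)) 0 0 <= 0.
  have addE (M N : 'M[R]_1) : (M + N) 0 0 = M 0 0 + N 0 0 by rewrite mxE.
  by move: eqn ge0; rewrite [(r + _)^T]linearD mulmxDl !mulmxDr !addE sym; lra.
have -> : (- (lambda *: (A^T *m r)))^T *m d = - (lambda *: (r^T *m (A *m d))).
  by rewrite linearN linearZ /= mulNmx -scalemxAl trmx_mul trmxK mulmxA.
have -> (M : 'M[R]_1) : (- (lambda *: M)) 0 0 = - (lambda * M 0 0).
  by rewrite !mxE.
by rewrite oppr_ge0 mulr_ge0_le0.
Qed.

End Descent.

(** * Iterates in the Krylov basis and conclusion *)

Lemma mulmx_V_ybar (R : realType) (m n : nat) (A : 'M[R]_(m, n))
    (b : 'cV[R]_m) (sigma : R) (Psi : 'cV[R]_n -> R^o) (s : pn_iterates R n)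
    (j : nat) :
  projected_newton_run A b sigma Psi s j -> V_ s (j + 1) *m ybar_ s j = x_ s j.
Proof.
case: j => [|i] run.
  by rewrite (pn_ybar0 run) (pn_x0 run) mulmx0.
have := pn_iter run (ltnSn i).
rewrite -[i.+1]addn1 => -[_ _ _ _ _ -> -> ->].
(* The zero appended to [y_] cancels the new Gram-Schmidt column. *)
by rewrite mul_row_col mulmx0 addr0.
Qed.

(** V V^T is the orthogonal projector onto the range of V, and that range contains every generator:
    vtilde_i = V D^T for some D, and V^T V = 1. *)
Lemma krylov_basis_proj (R : realType) (m n : nat) (A : 'M[R]_(m, n))
    (b : 'cV[R]_m) (Psi : 'cV[R]_n -> R^o) (s : pn_iterates R n) (k : nat)
    (V : 'M[R]_(n, k)) (i : 'I_k) :
  krylov_basis A b Psi s V ->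
  V *m V^T *m vtilde A b Psi s i = vtilde A b Psi s i.
Proof.
move=> [orthV rangeV].
have : ((vtilde A b Psi s i)^T <= V^T)%MS.
  rewrite rangeV; apply: (submx_trans _ (row_sub i _)).
  by rewrite rowK.
move=> /submxP[D /(congr1 trmx)]; rewrite trmxK trmx_mul trmxK => ->.
by rewrite -mulmxA (mulmxA V^T) orthV mul1mx.
Qed.

Theorem theorem4p1 (R : realType) (m n : nat) (A : 'M[R]_(m, n))
    (b : 'cV[R]_m) (sigma : R) (Psi : 'cV[R]_n -> R^o)
    (sigma_gt0 : 0 < sigma) (sigma_lt : sigma < norm2 b)
    (Psi_convex : @convex_function R 'cV[R]_n [set: _] Psi)
    (Psi_C2 : twice_continuously_differentiable Psi)
    (grad_Psi0 : grad Psi 0 = 0)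
    (* the index k >= 1 of the projected Newton direction is k = j + 1 *)
    (s : pn_iterates R n) (j : nat)
    (run : projected_newton_run A b sigma Psi s j)
    (basis : krylov_basis A b Psi s (V_ s (j + 1)))
    (lam_gt0 : 0 < lam_ s j)
    (nonsingular :
       projJ A b Psi (V_ s (j + 1)) (ybar_ s j) (lam_ s j) \in unitmx)
    (dy : 'cV[R]_(j + 1)) (dlam : R)
    (direction : newton_direction A b sigma Psi
                   (V_ s (j + 1)) (ybar_ s j) (lam_ s j) dy dlam) :
  let dx := V_ s (j + 1) *m dy in
  let Delta := col_mx dx dlam%:M : 'cV[R]_(n + 1) in
  (Delta^T *m grad (merit A b sigma Psi)
                   (col_mx (x_ s j) (lam_ s j)%:M)) 0 0 < 0
  \/ (global_solution A b sigma Psi (x_ s j)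
      /\ lagrange_multiplier A b sigma Psi (x_ s j) (lam_ s j)).
Proof.
move=> dx Delta; have [dPsi dgrad _] := Psi_C2.
have jlt : (j < j + 1)%N by rewrite addn1.
(* The last index [j] is chosen because [vtilde] there is exactly the first block of F at (x_j,
   lambda_j), which the descent identity requires to be fixed by V V^T. *)
have := krylov_basis_proj (Ordinal jlt) basis.
have xE := mulmx_V_ybar run; rewrite /vtilde /= -xE => proj.
rewrite (newton_direction_descent (dgrad _) proj direction).
set F := Ffun _ _ _ _ _ _; have [F0|F0] := eqVneq (norm2 F) 0.
  by right; apply: Ffun_eq0_solution (ltW lam_gt0) (norm2_eq0 F0).
by left; rewrite oppr_lt0 exprn_even_gt0.
Qed.
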